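(* Assume $\mathcal{P}$ is a hereditary graph property such that for any $G_1,G_2\in\mathcal{P}$ and any vertices $v_1\in V(G_1)$, $v_2\in V(G_2)$, the graph obtained from the disjoint union $G_1\cup G_2$ by identifying the vertices $v_1$ and $v_2$ also lies in $\mathcal{P}$. Then $\mathcal{P}$ is uniform.
   Context: Graphs are simple and undirected. A graph property $\mathcal{P}$ is a collection of finite labelled graphs closed under isomorphism; it is hereditary if every induced subgraph of a graph in $\mathcal{P}$ is in $\mathcal{P}$. A random ordering of a finite graph $G$ is a probability distribution on the set of all total orderings of $V(G)$. A consistent random ordering model on a hereditary property $\mathcal{P}$ assigns to each $G\in\mathcal{P}$ a random ordering $\mathbb{P}_G$ of $V(G)$ such that whenever $H,G\in\mathcal{P}$ and $\phi$ is an isomorphism from $H$ onto an induced subgraph of $G$, then for all $x_1,\dots,x_k\in V(H)$, $\mathbb{P}_H(x_1<x_2<\dots<x_k)=\mathbb{P}_G(\phi(x_1)<\phi(x_2)<\dots<\phi(x_k))$. The uniform model takes $\mathbb{P}_G$ to be the uniform distribution on all $|V(G)|!$ orderings for each $G\in\mathcal{P}$; it is consistent. The property $\mathcal{P}$ is called uniform if the uniform model is the only consistent random ordering model on $\mathcal{P}$. *)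

(* Defs.v *)
From HB Require Import structures.
From mathcomp Require Import all_boot all_order fingroup perm all_algebra.
From mathcomp Require Import reals.

Set Implicit Arguments.
Unset Strict Implicit.
Unset Printing Implicit Defensive.

Import Order.TTheory GRing.Theory Num.Theory.
Local Open Scope ring_scope.

Record graph : Type := Graph {
  vertex :> finType;
  adj : rel vertex;
  adj_sym : symmetric adj;
  adj_irr : irreflexive adj
}.

Definition isomorphism (G H : graph) (f : G -> H) : Prop :=
  bijective f /\ forall x y : G, adj (f x) (f y) = adj x y.

Definition isomorphic (G H : graph) : Prop :=
  exists f : G -> H, isomorphism f.

Section Induced.
Variables (G : graph) (S : {set G}).

Definition induced_vertex : finType := {x : G | x \in S}.
Definition induced_adj (x y : induced_vertex) : bool := adj (val x) (val y).

Lemma induced_adj_sym : symmetric induced_adj.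
Proof. by move=> x y; apply: adj_sym. Qed.

Lemma induced_adj_irr : irreflexive induced_adj.
Proof. by move=> x; apply: adj_irr. Qed.

Definition induced : graph := Graph induced_adj_sym induced_adj_irr.
End Induced.

Section DisjointUnion.
Variables G1 G2 : graph.

Definition dunion_adj (x y : G1 + G2) : bool :=
  match x, y with
  | inl x1, inl y1 => adj x1 y1
  | inr x2, inr y2 => adj x2 y2
  | _, _ => false
  end.

Lemma dunion_adj_sym : symmetric dunion_adj.
Proof. by case=> [x|x] [y|y] //=; apply: adj_sym. Qed.

Lemma dunion_adj_irr : irreflexive dunion_adj.
Proof. by case=> [x|x] /=; apply: adj_irr. Qed.

Definition dunion : graph := Graph dunion_adj_sym dunion_adj_irr.
End DisjointUnion.

(** [identify u v] is the quotient of [G] by the identification of [v] with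
    [u], meant for [u != v]: the merged vertex is represented by [u], and two
    distinct classes are adjacent when some of their representatives are. *)
Section Identify.
Variables (G : graph) (u v : G).

Definition identify_repr (z : G) : G := if z == v then u else z.

Definition identify_vertex : finType := {z : G | z != v}.

Definition identify_adj (a b : identify_vertex) : bool :=
  (a != b) &&
  [exists x : G, exists y : G,
     [&& identify_repr x == val a, identify_repr y == val b & adj x y]].

Lemma identify_adj_sym : symmetric identify_adj.
Proof.
suff imp a b : identify_adj a b -> identify_adj b a by move=> a b; apply/idP/idP; apply: imp.
case/andP=> ab /existsP[x /existsP[y /and3P[xa yb xy]]].
rewrite /identify_adj eq_sym ab; apply/existsP; exists y; apply/existsP; exists x.
by rewrite xa yb adj_sym.
Qed.

Lemma identify_adj_irr : irreflexive identify_adj.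
Proof. by move=> a; rewrite /identify_adj eqxx. Qed.

Definition identify : graph := Graph identify_adj_sym identify_adj_irr.
End Identify.

Definition glue (G1 G2 : graph) (v1 : G1) (v2 : G2) : graph :=
  identify (inl v1 : dunion G1 G2) (inr v2 : dunion G1 G2).

Definition graph_property (P : graph -> Prop) : Prop :=
  forall G H : graph, isomorphic G H -> P G -> P H.

Definition hereditary (P : graph -> Prop) : Prop :=
  forall (G : graph) (S : {set G}), P G -> P (induced S).

Definition glue_closed (P : graph -> Prop) : Prop :=
  forall (G1 G2 : graph) (v1 : G1) (v2 : G2),
    P G1 -> P G2 -> P (glue v1 v2).

(** The strict order relation is tabulated as a finite function, so that
    [ordering T] is a finite type. *)
Definition strict_total_order (T : finType) (r : rel T) : bool :=
  [&& [forall x, ~~ r x x],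
      [forall x, forall y, forall z, r x y && r y z ==> r x z]
    & [forall x, forall y, (x != y) ==> r x y || r y x]].

Record ordering (T : finType) : predArgType := Ordering {
  ord_table : {ffun T * T -> bool};
  ord_tableP : strict_total_order (fun x y => ord_table (x, y))
}.

HB.instance Definition _ (T : finType) := [isSub of ordering T for @ord_table T].
HB.instance Definition _ (T : finType) := [Countable of ordering T by <:].
HB.instance Definition _ (T : finType) := [Finite of ordering T by <:].

Definition ord_lt (T : finType) (o : ordering T) : rel T :=
  fun x y => ord_table o (x, y).

Section OrderingTheory.
Variable T : finType.
Implicit Types (o : ordering T) (s : {perm T}).

Lemma ord_lt_irr o : irreflexive (ord_lt o).
Proof. by move=> x; have /and3P[/forallP/(_ x)/negbTE] := ord_tableP o. Qed.

Lemma ord_lt_trans o : transitive (ord_lt o).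
Proof.
move=> y x z xy yz; have /and3P[_ /forallP/(_ x)/forallP/(_ y) imp _] := ord_tableP o.
by have /implyP := forallP imp z; apply; apply/andP.
Qed.

Lemma ord_lt_total o x y : x != y -> ord_lt o x y || ord_lt o y x.
Proof.
have /and3P[_ _ /forallP/(_ x)/forallP/(_ y)/implyP] := ord_tableP o.
exact.
Qed.

Lemma ord_lt_inj o1 o2 : ord_lt o1 =2 ord_lt o2 -> o1 = o2.
Proof. by move=> e; apply: val_inj; apply/ffunP=> -[x y]; apply: e. Qed.

Lemma rank_ordering_subproof (f : T -> nat) (f_inj : injective f) :
  strict_total_order
    (fun x y => [ffun p : T * T => (f p.1 < f p.2)%N] (x, y)).
Proof.
apply/and3P; split.
- by apply/forallP=> x; rewrite ffunE ltnn.
- do 3![apply/forallP => ?]; rewrite !ffunE /=; apply/implyP=> /andP[].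
  exact: ltn_trans.
- do 2![apply/forallP => ?]; rewrite !ffunE /=; apply/implyP.
  by rewrite -neq_ltn; apply: contra => /eqP/f_inj->.
Qed.

Definition rank_ordering (f : T -> nat) (f_inj : injective f) : ordering T :=
  Ordering (rank_ordering_subproof f_inj).

Lemma rank_orderingE f (f_inj : injective f) x y :
  ord_lt (rank_ordering f_inj) x y = (f x < f y)%N.
Proof. by rewrite /ord_lt ffunE. Qed.

Lemma perm_rank_inj s : injective (fun x => val (enum_rank (s x))).
Proof. by move=> x y /val_inj/enum_rank_inj/perm_inj. Qed.

Lemma ordering_rank_lt o x : (#|[pred y | ord_lt o y x]| < #|T|)%N.
Proof.
apply: (@leq_trans #|[predU1 x & [pred y | ord_lt o y x]]|); last exact: max_card.
by rewrite cardU1 inE ord_lt_irr.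
Qed.

Lemma ordering_rank_mono o x y :
  (#|[pred z | ord_lt o z x]| < #|[pred z | ord_lt o z y]|)%N = ord_lt o x y.
Proof.
have imp a b : ord_lt o a b ->
    (#|[pred z | ord_lt o z a]| < #|[pred z | ord_lt o z b]|)%N.
  move=> ab; apply/proper_card/properP; split.
    by apply/subsetP=> z; rewrite !inE => /ord_lt_trans; apply.
  by exists a; rewrite !inE // ord_lt_irr.
apply/idP/idP; last exact: imp.
have [->|xy] := eqVneq x y; first by rewrite ltnn.
case/orP: (ord_lt_total o xy) => // /imp yx xy'.
by move: (ltn_trans yx xy'); rewrite ltnn.
Qed.

Lemma card_ord_lt (n m : nat) : (m <= n)%N -> #|[pred i : 'I_n | (i < m)%N]| = m.
Proof.
move=> le_mn; rewrite -sum1_card (eq_bigl (fun i : 'I_n => i < m)%N) //.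
by rewrite (big_ord_narrow le_mn) sum1_card card_ord.
Qed.

Lemma card_ordering : #|ordering T| = #|T|`!.
Proof.
have -> : #|T|`! = #|{perm T}|.
  rewrite -[in LHS]cardsT -card_perm; apply: eq_card => s; rewrite !inE.
  by apply/subsetP=> x; rewrite inE.
pose F s := rank_ordering (@perm_rank_inj s).
have rank_inj o : injective (fun x => enum_val (Ordinal (ordering_rank_lt o x))).
  move=> x y /enum_val_inj/(congr1 val)/= e; apply/eqP; apply: contraT => xy.
  by case/orP: (ord_lt_total o xy); rewrite -ordering_rank_mono e ltnn.
pose K o := perm (@rank_inj o).
have KF : cancel K F.
  move=> o; apply: ord_lt_inj => x y.
  by rewrite rank_orderingE !permE !enum_valK /= ordering_rank_mono.
have FK : cancel F K.
  move=> s; apply/permP=> x; rewrite permE; apply: enum_rank_inj.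
  rewrite enum_valK; apply: val_inj => /=.
  have r_inj : injective (fun y => enum_rank (s y)).
    by move=> a b /enum_rank_inj/perm_inj.
  pose A := [pred y | enum_rank (s y) < enum_rank (s x)]%N.
  transitivity #|A|; first by apply: eq_card => y; rewrite !inE rank_orderingE.
  transitivity #|[pred i : 'I_#|T| | i < enum_rank (s x)]%N|; last first.
    exact/card_ord_lt/ltnW/ltn_ord.
  rewrite -(card_image r_inj A).
  apply: eq_card => i; rewrite !inE; apply/imageP/idP => [[y]|lt_i].
    by rewrite inE => ? ->.
  exists ((s^-1)%g (enum_val i)); first by rewrite inE permKV enum_valK.
  by rewrite permKV enum_valK.
by apply: bij_eq_card (Bijective KF FK).
Qed.
End OrderingTheory.

Record random_ordering (R : realType) (T : finType) : Type := RandomOrdering {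
  mass :> ordering T -> R;
  mass_ge0 : forall o, 0 <= mass o;
  mass_sum1 : \sum_(o : ordering T) mass o = 1
}.

(** [prob_chain mu [:: x1; ...; xk]] is the probability that
    [x1 < x2 < ... < xk]. *)
Definition prob_chain (R : realType) (T : finType)
    (mu : random_ordering R T) (xs : seq T) : R :=
  \sum_(o : ordering T | sorted (ord_lt o) xs) mu o.

Section Uniform.
Variables (R : realType) (T : finType).

Definition uniform_mass (o : ordering T) : R := (#|T|`!)%:R^-1.

Lemma uniform_mass_ge0 o : 0 <= uniform_mass o.
Proof. by rewrite invr_ge0 ler0n. Qed.

Lemma uniform_mass_sum1 : \sum_(o : ordering T) uniform_mass o = 1.
Proof.
rewrite /uniform_mass sumr_const card_ordering -[LHS]mulr_natl divff //.
by rewrite pnatr_eq0 -lt0n fact_gt0.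
Qed.

Definition uniform_ordering : random_ordering R T :=
  RandomOrdering uniform_mass_ge0 uniform_mass_sum1.
End Uniform.

Definition ordering_model (R : realType) (P : graph -> Prop) : Type :=
  forall G : graph, P G -> random_ordering R G.

Definition consistent (R : realType) (P : graph -> Prop)
    (M : ordering_model R P) : Prop :=
  forall (H G : graph) (PH : P H) (PG : P G) (S : {set G})
         (phi : H -> induced S),
    isomorphism phi ->
    forall xs : seq H,
      prob_chain (M H PH) xs = prob_chain (M G PG) [seq val (phi x) | x <- xs].

Definition uniform_model (R : realType) (P : graph -> Prop) :
    ordering_model R P :=
  fun G _ => uniform_ordering R G.

Definition uniform_property (R : realType) (P : graph -> Prop) : Prop :=
  consistent (@uniform_model R P) /\
  forall M : ordering_model R P, consistent M ->
    forall (G : graph) (PG : P G), M G PG =1 @uniform_model R P G PG.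

(* Main.v *)
Require Import Defs.
From mathcomp Require Import all_boot all_order fingroup perm all_algebra.
From mathcomp Require Import reals.
From mathcomp Require Import ring zify.

(** Why the theorem holds. Let [M] be a consistent model. Two mechanisms force
    uniformity, both of them second moment arguments.

    Decoupling ([decouple]). Suppose that a set [W] of vertices of [G] is joined
    to the rest of [G] through a single vertex [v]. Gluing copies of [G] at [v]
    gives graphs in the property in which many disjoint copies of [W] hang on
    [v], each forming a copy of [G] with the rest ([hanging_copies]). Any
    correlation between the ordering of the rest and that of [W] would occur
    for all the copies at once; if two disjoint copies of [W] are ordered
    uniformly, observables of distinct copies are uncorrelated, and a
    fixed variable cannot correlate with many uncorrelated ones. Hence the
    orderings of [W] and of the rest are independent, and that of [W] is
    uniform.

    Interleaving ([interleave_bound]). Independence of the internal orderings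
    of [W] and of its complement does not say how the two are interleaved. But
    isolated vertices can be added for free ([isolated_vertices]): each side
    receives [n] of them as probes, and decoupling is applied to the
    sides with their probes. The number of probes of its own side below a vertex
    approximates the position of that vertex, and these numbers are functions of
    the internal orderings, hence distributed as in the uniform model. For large
    [n] they determine the interleaving, up to a vanishing probability.

    These are combined by induction ([bounded_classes_uniform]): a component
    is split into a vertex [v] and the rest [W]; the graph with [W] deleted and the
    disjoint union of two copies of [W] are both simpler once complexity is
    measured by the sizes of components. The induction starts from edgeless graphs,
    all of whose permutations are automorphisms. *)

Set Implicit Arguments.
Unset Strict Implicit.
Unset Printing Implicit Defensive.
Import Order.TTheory GRing.Theory Num.Theory.
Local Open Scope ring_scope.

(** * Tables of orderings and expectations *)

(** Tables of arbitrary binary relations, rather than orderings, so that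
    restriction along a map is total: no injectivity proof is carried around,
    and restrictions compose without side conditions. *)
Definition table (T : finType) := {ffun T * T -> bool}.

Definition restr (S T : finType) (f : S -> T) (r : table T) : table S :=
  [ffun p => r (f p.1, f p.2)].

Lemma restr_comp (S T V : finType) (f : S -> T) (g : T -> V) (r : table V) :
  restr f (restr g r) = restr (g \o f) r.
Proof. by apply/ffunP=> p; rewrite !ffunE. Qed.

Lemma eq_restr (S T : finType) (f g : S -> T) : f =1 g -> restr f =1 restr g.
Proof. by move=> fg r; apply/ffunP=> p; rewrite !ffunE !fg. Qed.

Section Pull.
Variables (S T : finType) (f : S -> T) (f_inj : injective f).

Lemma restr_strict_total (o : ordering T) :
  strict_total_order (fun x y => restr f (ord_table o) (x, y)).
Proof.
apply/and3P; split.
- by apply/forallP=> x; rewrite ffunE; apply/negbT/ord_lt_irr.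
- do 3![apply/forallP => ?]; rewrite !ffunE /=; apply/implyP=> /andP[].
  exact: ord_lt_trans.
- do 2![apply/forallP => ?]; rewrite !ffunE /=; apply/implyP => xy.
  by apply: ord_lt_total; apply: contra xy => /eqP/f_inj->.
Qed.

Definition pull (o : ordering T) : ordering S := Ordering (restr_strict_total o).

End Pull.

(** The weight [mu] is any function, so that linearity needs no positivity;
    only the values of [F] on tables of orderings count. *)
Definition expect (R : realType) (T : finType) (mu : ordering T -> R)
  (F : table T -> R) : R := \sum_o mu o * F (ord_table o).

Section Expectation.
Variables (R : realType) (T : finType) (mu : ordering T -> R).
Implicit Types F : table T -> R.

Lemma eq_expect F1 F2 : (forall o, F1 (ord_table o) = F2 (ord_table o)) ->
  expect mu F1 = expect mu F2.
Proof. by move=> e; apply: eq_bigr => o _; rewrite e. Qed.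

Lemma expectD F1 F2 : expect mu (fun r => F1 r + F2 r) = expect mu F1 + expect mu F2.
Proof. by rewrite -big_split; apply: eq_bigr => o _; rewrite mulrDr. Qed.

Lemma expectZ c F : expect mu (fun r => c * F r) = c * expect mu F.
Proof. by rewrite /expect mulr_sumr; apply: eq_bigr => o _; rewrite mulrCA. Qed.

Lemma expectB F1 F2 : expect mu (fun r => F1 r - F2 r) = expect mu F1 - expect mu F2.
Proof.
rewrite -[X in _ - X]mul1r -mulNr -expectZ -expectD; apply: eq_expect => o.
by rewrite mulN1r.
Qed.

Lemma expect_sum (I : Type) (s : seq I) (P : pred I) (F : I -> table T -> R) :
  expect mu (fun r => \sum_(i <- s | P i) F i r) = \sum_(i <- s | P i) expect mu (F i).
Proof.
rewrite /expect [RHS]exchange_big; apply: eq_bigr => o _.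
by rewrite mulr_sumr.
Qed.

(** Second moments of sums are read off from pair correlations; both limit
    arguments of the proof go through this identity. *)
Lemma expect_sqr_sum (n : nat) (Y : 'I_n -> table T -> R) :
  expect mu (fun r => (\sum_i Y i r) ^+ 2) =
  \sum_i \sum_j expect mu (fun r => Y i r * Y j r).
Proof.
transitivity (expect mu (fun r => \sum_i \sum_j Y i r * Y j r)).
  apply: eq_expect => o; rewrite expr2 mulr_suml; apply: eq_bigr => i _.
  by rewrite mulr_sumr.
by rewrite expect_sum; apply: eq_bigr => i _; rewrite expect_sum.
Qed.

End Expectation.

Section Probability.
Variables (R : realType) (T : finType) (mu : random_ordering R T).
Implicit Types F : table T -> R.

Lemma expect_cst c : expect mu (fun=> c) = c.
Proof. by rewrite /expect -mulr_suml mass_sum1 mul1r. Qed.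

Lemma le_expect F1 F2 : (forall o, F1 (ord_table o) <= F2 (ord_table o)) ->
  expect mu F1 <= expect mu F2.
Proof. by move=> le12; apply: ler_sum => o _; apply/ler_wpM2l/le12/mass_ge0. Qed.

Lemma expect_ge0 F : (forall o, 0 <= F (ord_table o)) -> 0 <= expect mu F.
Proof. by move=> F0; rewrite -(expect_cst 0); apply: le_expect. Qed.

Lemma norm_expect F : `|expect mu F| <= expect mu (fun r => `|F r|).
Proof.
apply: le_trans (ler_norm_sum _ _ _) _; apply: ler_sum => o _.
by rewrite normrM ger0_norm // mass_ge0.
Qed.

End Probability.

(** * Uniform orderings *)

Section PermAction.
Variable T : finType.
Implicit Types (o : ordering T) (s : {perm T}).

Lemma pull_perm_bij s : bijective (pull (@perm_inj T s)).
Proof.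
exists (pull (@perm_inj T s^-1%g)) => o; apply: val_inj => /=;
  rewrite restr_comp; apply/ffunP => -[x y]; rewrite !ffunE /=.
  by rewrite !permKV.
by rewrite !permK.
Qed.

(** The symmetric group acts simply transitively on orderings: a permutation
    can be recovered from [pull s o], since the rank of [s x] in [o] is the rank
    of [x] in [pull s o], and the two sets have the same cardinality. *)
Lemma pull_orbit_bij o : bijective (fun s => pull (@perm_inj T s) o).
Proof.
apply: inj_card_bij => [s1 s2 /(congr1 (@ord_table T))/= e|]; last first.
  rewrite card_ordering -[X in X`!]cardsT -card_perm; apply: subset_leq_card.
  by apply/subsetP.
have e12 x y : ord_lt o (s1 x) (s1 y) = ord_lt o (s2 x) (s2 y).
  by move/ffunP: e => /(_ (x, y)); rewrite !ffunE.
have rank s x :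
    #|[pred y | ord_lt o y (s x)]| = #|[pred y | ord_lt o (s y) (s x)]|.
  rewrite -[RHS](card_image (@perm_inj _ s)); apply: eq_card => y.
  rewrite inE; apply/idP/imageP => [yx|[z]]; last by rewrite inE => ? ->.
  by exists (s^-1%g y); rewrite ?inE permKV.
apply/permP=> x; apply/eqP; apply: contraT => ne.
have: #|[pred y | ord_lt o y (s1 x)]| = #|[pred y | ord_lt o y (s2 x)]|.
  by rewrite !rank; apply: eq_card => y; rewrite !inE e12.
move=> er; case/orP: (ord_lt_total o ne);
  by rewrite -ordering_rank_mono er ltnn.
Qed.

End PermAction.

Notation unif R T := (uniform_ordering R T).

Section Uniform.
Variables (R : realType).

Lemma unifE (T : finType) (F : table T -> R) :
  expect (unif R T) F = (#|T|`!)%:R^-1 * \sum_o F (ord_table o).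
Proof. by rewrite /expect mulr_sumr. Qed.

Lemma unif_perm (T : finType) (s : {perm T}) (F : table T -> R) :
  expect (unif R T) (fun r => F (restr s r)) = expect (unif R T) F.
Proof.
rewrite !unifE; congr (_ * _).
by rewrite [RHS](reindex (pull (@perm_inj T s))) //; apply/onW_bij/pull_perm_bij.
Qed.

Lemma fact_neq0 n : (n`!)%:R != 0 :> R.
Proof. by rewrite pnatr_eq0 -lt0n fact_gt0. Qed.

(** Averaging over all relabellings of a single ordering is averaging over all
    orderings. This turns any invariance under permutations into uniformity. *)
Lemma perm_average (T : finType) (o : ordering T) (F : table T -> R) :
  \sum_(s : {perm T}) F (restr s (ord_table o)) =
  (#|T|`!)%:R * expect (unif R T) F.
Proof.
rewrite unifE mulrA divff ?fact_neq0 // mul1r.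
rewrite [RHS](reindex (fun s => pull (@perm_inj T s) o)) //.
exact/onW_bij/pull_orbit_bij.
Qed.

Lemma card_permT (T : finType) : #|{perm T}| = #|T|`!.
Proof.
rewrite -[in RHS]cardsT -card_perm; apply: eq_card => s; rewrite !inE.
by apply/esym/subsetP=> x; rewrite inE.
Qed.

Lemma exchangeable_uniform (T : finType) (mu : random_ordering R T) :
  (forall (s : {perm T}) F, expect mu (fun r => F (restr s r)) = expect mu F) ->
  forall F, expect mu F = expect (unif R T) F.
Proof.
move=> inv F; apply: (mulfI (fact_neq0 #|T|)).
rewrite -[RHS](expect_cst mu) -[in LHS]card_permT -sum1_card natr_sum mulr_suml.
under eq_bigr => s _ do rewrite mul1r -(inv s).
by rewrite -expect_sum; apply: eq_expect => o; rewrite perm_average.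
Qed.

Section Extend.
Variables (S T : finType) (f : S -> T) (f_inj : injective f) (s : {perm S}).

Let ext_fun (y : T) : T :=
  if [pick x | f x == y] is Some x then f (s x) else y.

Let ext_funf x : ext_fun (f x) = f (s x).
Proof.
rewrite /ext_fun; case: pickP => [z /eqP/f_inj-> //|/(_ x)].
by rewrite eqxx.
Qed.

Let ext_fun_id y : (forall x, f x != y) -> ext_fun y = y.
Proof. by rewrite /ext_fun => ny; case: pickP => // x; rewrite (negbTE (ny x)). Qed.

Let ext_fun_inj : injective ext_fun.
Proof.
have cases y : (exists x, y = f x) \/ (forall x, f x != y).
  case: (pickP (fun x => f x == y)) => [x /eqP<-|n]; first by left; exists x.
  by right=> x; rewrite n.
move=> y z; case: (cases y) => [[x ->]|ny]; case: (cases z) => [[x' ->]|nz].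
- by rewrite !ext_funf => /f_inj/perm_inj->.
- by rewrite ext_funf (ext_fun_id nz) => e; have := nz (s x); rewrite e eqxx.
- by rewrite ext_funf (ext_fun_id ny) => e; have := ny (s x'); rewrite e eqxx.
- by rewrite !ext_fun_id.
Qed.

(** The permutation of [T] that copies [s] on the image of [f]. *)
Definition ext_perm : {perm T} := perm ext_fun_inj.

Lemma ext_permf x : ext_perm (f x) = f (s x).
Proof. by rewrite permE ext_funf. Qed.

Lemma ext_perm_id y : (forall x, f x != y) -> ext_perm y = y.
Proof. by rewrite permE => /ext_fun_id. Qed.

End Extend.

(** Relabelling the image of [f] by all [ext_perm s] leaves the uniform law
    and [Z] unchanged, and averages [F] to its uniform expectation. *)
Lemma unif_factor (S T : finType) (f : S -> T) (f_inj : injective f)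
    (F : table S -> R) (Z : table T -> R) :
  (forall s r, Z (restr (ext_perm f_inj s) r) = Z r) ->
  expect (unif R T) (fun r => F (restr f r) * Z r) =
  expect (unif R S) F * expect (unif R T) Z.
Proof.
move=> Zinv; apply: (mulfI (fact_neq0 #|S|)); rewrite mulrA -[RHS]expectZ.
rewrite -[in LHS]card_permT -sum1_card natr_sum mulr_suml.
under eq_bigr => s _ do rewrite mul1r -(unif_perm (ext_perm f_inj s)).
rewrite -expect_sum; apply: eq_expect => o.
rewrite -(perm_average (pull f_inj o)) mulr_suml; apply: eq_bigr => s _.
rewrite Zinv; congr (F _ * _); rewrite !restr_comp.
by apply: eq_restr => x /=; rewrite ext_permf.
Qed.

Lemma unif_restr (S T : finType) (f : S -> T) (f_inj : injective f)
    (F : table S -> R) :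
  expect (unif R T) (fun r => F (restr f r)) = expect (unif R S) F.
Proof.
have := @unif_factor _ _ _ f_inj F (fun=> 1) (fun _ _ => erefl).
by rewrite expect_cst mulr1 => <-; apply: eq_expect => o; rewrite mulr1.
Qed.

Lemma unif_indep (S1 S2 T : finType) (f1 : S1 -> T) (f2 : S2 -> T)
    (F1 : table S1 -> R) (F2 : table S2 -> R) :
  injective f1 -> injective f2 -> (forall x y, f1 x != f2 y) ->
  expect (unif R T) (fun r => F1 (restr f1 r) * F2 (restr f2 r)) =
  expect (unif R S1) F1 * expect (unif R S2) F2.
Proof.
move=> inj1 inj2 dis; rewrite (@unif_factor _ _ _ inj1) ?(unif_restr inj2) // => s r.
rewrite restr_comp; congr F2; apply: eq_restr => y /=.
by rewrite ext_perm_id.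
Qed.

End Uniform.

(** * Embeddings and amalgams of graphs *)

(** Isomorphisms onto induced subgraphs, without naming the induced subgraph. *)
Definition embedding (H G : graph) (f : H -> G) : Prop :=
  injective f /\ forall x y, adj (f x) (f y) = adj x y.

Lemma eq_embedding (H G : graph) (f g : H -> G) :
  f =1 g -> embedding f -> embedding g.
Proof.
move=> fg [f_inj f_adj]; split=> [|x y]; last by rewrite -!fg.
exact: eq_inj f_inj fg.
Qed.

Lemma embedding_comp (H G K : graph) (f : H -> G) (g : G -> K) :
  embedding f -> embedding g -> embedding (g \o f).
Proof.
move=> [f_inj f_adj] [g_inj g_adj]; split; first exact: inj_comp.
by move=> x y /=; rewrite g_adj f_adj.
Qed.

Lemma embedding_val (G : graph) (S : {set G}) :
  embedding (val : induced S -> G).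
Proof. by split; first exact: val_inj. Qed.

Section Image.
Variables (H G : graph) (f : H -> G) (f_emb : embedding f).

Definition to_image (x : H) : induced (f @: [set: H]) :=
  exist _ (f x) (imset_f f (in_setT x)).

Lemma to_image_iso : isomorphism to_image.
Proof.
have [f_inj f_adj] := f_emb; split; last by move=> x y; apply: f_adj.
apply: inj_card_bij => [x y /(congr1 val)/f_inj //|].
by rewrite card_sig [X in (X <= _)%N](card_imset _ f_inj) cardsT.
Qed.

End Image.

Lemma closed_embedding (P : graph -> Prop) : graph_property P -> hereditary P ->
  forall (H G : graph) (f : H -> G), embedding f -> P G -> P H.
Proof.
move=> Piso Pher H G f f_emb PG.
apply: Piso (Pher G (f @: [set: H]) PG).
have [[g fK gK] f_adj] := to_image_iso f_emb.
exists g; split; first by exists (@to_image _ _ f).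
by move=> x y; rewrite -f_adj !gK.
Qed.

(** What the quotient construction [glue] provides: the two graphs are embedded
    with [v1] and [v2] at the same place, and are otherwise disjoint and
    nonadjacent. Later arguments use [glue] only through this interface. *)
Lemma glue_amalgam (P : graph -> Prop) (G1 G2 : graph) (v1 : G1) (v2 : G2) :
  glue_closed P -> P G1 -> P G2 ->
  exists (K : graph) (e1 : G1 -> K) (e2 : G2 -> K),
  [/\ P K, embedding e1, embedding e2, e1 v1 = e2 v2 &
      forall x y, y != v2 ->
        e1 x != e2 y /\ (x != v1 -> adj (e1 x) (e2 y) = false)].
Proof.
move=> Pglue P1 P2; pose K := glue v1 v2.
pose rep (z : G1 + G2) : G1 + G2 :=
  if z is inr y then if y == v2 then inl v1 else inr y else z.
have repE z : identify_repr (inl v1 : dunion G1 G2) (inr v2) z = rep z.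
  by case: z => [x|y].
have repP z : rep z != inr v2.
  by case: z => [x|y] //=; case: ifP => // /negbT.
pose e1 (x : G1) : K := exist _ (rep (inl x)) (repP (inl x)).
pose e2 (y : G2) : K := exist _ (rep (inr y)) (repP (inr y)).
have adjP (a b : K) : adj a b -> exists x y,
    [/\ rep x = val a, rep y = val b & dunion_adj x y].
  case/andP=> _ /existsP[x /existsP[y /and3P[/eqP ex /eqP ey xy]]].
  by exists x, y; rewrite -!repE.
have adjI (a b : K) x y : a != b -> rep x = val a -> rep y = val b ->
    dunion_adj x y -> adj a b.
  move=> ab ex ey xy; apply/andP; split=> //.
  by apply/existsP; exists x; apply/existsP; exists y; rewrite !repE ex ey !eqxx.
have e1_inj : injective e1 by move=> x y /(congr1 val) [].
have e2_inj : injective e2.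
  by move=> x y /(congr1 val)/=; case: eqP => [->|_]; case: eqP => [->|_] // [].
exists K, e1, e2; split.
- exact: Pglue.
- split=> // x y; apply/idP/idP => [/adjP[a [b []]]|xy].
    case: a b => [a|a] [b|b] //= => [[->] [->] //|].
    case: eqP => [->|//] _; case: eqP => [->|//] _.
    by rewrite (adj_irr v2).
  apply: (adjI _ _ (inl x) (inl y)) => //.
  by rewrite (inj_eq e1_inj); apply: contraTneq xy => ->; rewrite (adj_irr y).
- split=> // x y; apply/idP/idP => [/adjP[a [b []]]|xy].
    case: a b => [a|a] [b|b] //=.
      case: eqP => [_ [->]|//]; case: eqP => [_ [->]|//].
      by rewrite (adj_irr v1).
    move=> ea eb; have -> : a = x by apply: e2_inj; apply: val_inj.
    by have -> : b = y by apply: e2_inj; apply: val_inj.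
  apply: (adjI _ _ (inr x) (inr y)) => //.
  by rewrite (inj_eq e2_inj); apply: contraTneq xy => ->; rewrite (adj_irr y).
- by apply: val_inj; rewrite /= eqxx.
- move=> x y ny; split=> [|nx].
    by apply/eqP=> /(congr1 val)/=; rewrite (negbTE ny).
  apply/negP => /adjP[a [b []]]; case: a b => [a|a] [b|b] //=.
    by rewrite (negbTE ny).
  case: eqP => [_ [e]|//]; by rewrite e eqxx in nx.
Qed.

Definition empty_adj (T : finType) : rel T := fun _ _ => false.
Lemma empty_adj_sym (T : finType) : symmetric (@empty_adj T). Proof. by []. Qed.
Lemma empty_adj_irr (T : finType) : irreflexive (@empty_adj T). Proof. by []. Qed.
Definition empty_graph (T : finType) : graph :=
  Graph (@empty_adj_sym T) (@empty_adj_irr T).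

Section Closure.
Variable P : graph -> Prop.
Hypotheses (Piso : graph_property P) (Pher : hereditary P) (Pglue : glue_closed P).

(** When the only neighbour of [W] outside [W] is [v], copies of [G] that share
    everything but [W] fit together in [P]. One more copy is obtained by gluing
    all of [G] at [v]; from the glued graph only the new copy of [W] is kept,
    which together with the old copy of the rest forms a copy of [G]. *)
Lemma hanging_copies (G : graph) (v : G) (W : {set G}) (N : nat) : P G ->
  v \notin W -> (forall x y, x \in W -> y \notin W -> y != v -> adj x y = false) ->
  exists (K : graph) (g : nat -> G -> K), [/\ P K,
    forall i, (i <= N)%N -> embedding (g i),
    forall i x, x \notin W -> g i x = g 0%N x &
    forall i j x y, (i < j <= N)%N -> x \in W -> y \in W ->
      g i x != g j y /\ adj (g i x) (g j y) = false].
Proof.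
move=> PG vW hang; elim: N => [|N [K [g [PK g_emb g_out g_dis]]]].
  exists G, (fun _ x => x); split=> // [i _|i j x y /andP[]]; first by split.
  by move=> + j0; have -> : j = 0%N by apply/eqP; rewrite -leqn0.
have [K' [e1 [e2 [PK' e1_emb e2_emb e12 cross]]]] :=
  glue_amalgam (g 0%N v) v Pglue PK PG.
have Wv x : x \in W -> x != v by apply: contraTneq => ->.
have [g0_inj g0_adj] := g_emb 0%N isT.
have gv i x : (i <= N)%N -> x != v -> g i x != g 0%N v.
  move=> iN nxv.
  by have [gi_inj _] := g_emb i iN; rewrite -(g_out i v vW) (inj_eq gi_inj).
have [e1_inj e1_adj] := e1_emb; have [e2_inj e2_adj] := e2_emb.
pose g' i x := if (i <= N)%N then e1 (g i x)
               else if x \in W then e2 x else e1 (g 0%N x).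
exists K', g'; split=> //.
- move=> i iN1; have [iN|Ni] := leqP i N.
    apply: eq_embedding (embedding_comp (g_emb i iN) e1_emb) => x.
    by rewrite /g' iN.
  have g'E x : g' i x = if x \in W then e2 x else e1 (g 0%N x).
    by rewrite /g' leqNgt Ni.
  (* The only edges between the new copy of [W] and the old remainder pass
     through [v], where the two graphs are identified. *)
  have mixed x y : x \in W -> y \notin W ->
      e2 x != e1 (g 0%N y) /\ adj (e1 (g 0%N y)) (e2 x) = adj y x.
    move=> xW yW; have [ne na] := cross (g 0%N y) x (Wv x xW).
    split; first by rewrite eq_sym.
    have [->|nyv] := eqVneq y v; first by rewrite e12 e2_adj.
    by rewrite na ?gv // [RHS]adj_sym hang.
  split=> x y; rewrite !g'E.
    case: ifPn => xW; case: ifPn => yW.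
    - exact: e2_inj.
    - by have [/eqP] := mixed x y xW yW.
    - by have [/eqP ne _] := mixed y x yW xW; move/esym.
    - by move=> /e1_inj/g0_inj.
  case: ifPn => xW; case: ifPn => yW.
  - exact: e2_adj.
  - by have [_] := mixed x y xW yW; rewrite adj_sym [adj y x]adj_sym.
  - by have [_] := mixed y x yW xW.
  - by rewrite e1_adj g0_adj.
- move=> i x xW; rewrite /g' (negbTE xW) /=.
  by case: ifP => // _; rewrite g_out.
- move=> i j x y /andP[ij jN] xW yW.
  have iN : (i <= N)%N by rewrite -ltnS (leq_trans ij).
  rewrite /g' iN yW; have [jN'|Nj] := leqP j N.
    by have [] := g_dis i j x y; rewrite ?ij ?(inj_eq e1_inj) ?e1_adj.
  by have [ne na] := cross (g i x) y (Wv _ yW); split=> //; apply/na/gv/Wv.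
Qed.

(** Gluing [G] to itself at [v] produces two nonadjacent copies of [u]; gluing
    at one of them makes the other an isolated vertex next to a full copy of
    [G]. An isolated vertex hangs on any vertex, hence can be multiplied. *)
Lemma isolated_vertices (G : graph) (u v : G) (T : finType) : u != v -> P G ->
  P (dunion G (empty_graph T)).
Proof.
move=> uv PG.
have [K1 [a1 [a2 [PK1 a1_emb a2_emb a12 cross1]]]] := glue_amalgam v v Pglue PG PG.
have [_ /(_ uv) a_nadj] := cross1 u u uv.
have [a_ne _] := cross1 u u uv.
have [K [e1 [e2 [PK e1_emb e2_emb e12 cross]]]] :=
  glue_amalgam v (a1 u) Pglue PG PK1.
pose p := e2 (a2 u).
have p_new x : e1 x != p /\ adj (e1 x) p = false.
  have [|ne na] := cross x (a2 u); first by rewrite eq_sym.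
  split=> //; have [->|/na//] := eqVneq x v.
  by rewrite e12 (proj2 e2_emb).
pose G1 := dunion G (empty_graph unit).
have PG1 : P G1.
  pose f (z : G1) : K := if z is inl x then e1 x else p.
  apply: (closed_embedding Piso Pher _ PK (f := f)).
  split=> [[x|[]] [y|[]] //=|[x|[]] [y|[]] /=].
  - by have [e1_inj _] := e1_emb => /e1_inj->.
  - by have [/eqP] := p_new x.
  - by have [/eqP ne _] := p_new y => /esym.
  - exact: (proj2 e1_emb).
  - by have [] := p_new x.
  - by rewrite adj_sym; have [] := p_new y.
  - exact: adj_irr.
pose W : {set G1} := [set inr tt].
have [|x y|K2 [g [PK2 g_emb g_out g_dis]]] :=
  hanging_copies (v := inl v : G1) (W := W) #|T| PG1.
- by rewrite inE.
- by rewrite inE => /eqP ->; case: y.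
pose k (t : T) : nat := enum_rank t.
have k_inj : injective k by move=> s t /val_inj/enum_rank_inj.
have kT t : (k t <= #|T|)%N by apply/ltnW/ltn_ord.
have p_W : (inr tt : G1) \in W by rewrite inE.
have l_W x : (inl x : G1) \notin W by rewrite inE.
pose f (z : dunion G (empty_graph T)) : K2 :=
  match z with inl x => g 0%N (inl x) | inr t => g (k t) (inr tt) end.
have [g0_inj g0_adj] := g_emb 0%N isT.
have mixed x t : g 0%N (inl x) <> g (k t) (inr tt) /\
    adj (g 0%N (inl x)) (g (k t) (inr tt)) = false.
  have [gt_inj gt_adj] := g_emb (k t) (kT t).
  by rewrite -(g_out (k t) _ (l_W x)) gt_adj; split=> // /gt_inj.
have isol s t : s != t -> g (k s) (inr tt) != g (k t) (inr tt) /\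
    adj (g (k s) (inr tt)) (g (k t) (inr tt)) = false.
  move=> st; case: (ltngtP (k s) (k t)) => [lt|lt|/k_inj e].
  - by apply: g_dis; rewrite ?lt ?kT.
  - by rewrite eq_sym adj_sym; apply: g_dis; rewrite ?lt ?kT.
  - by rewrite e eqxx in st.
apply: (closed_embedding Piso Pher _ PK2 (f := f)).
split=> [[x|s] [y|t] /=|[x|s] [y|t] /=].
- by move/g0_inj => [->].
- by have [] := mixed x t.
- by have [ne _] := mixed y s => /esym.
- by move=> e; congr inr; apply/eqP; apply: contraT => /isol[/eqP].
- by rewrite g0_adj.
- by have [] := mixed x t.
- by rewrite adj_sym; have [] := mixed y s.
- have [->|/isol[] //] := eqVneq s t; exact: adj_irr.
Qed.

End Closure.

(** * Consistent models as laws on tables *)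

Lemma ord_lt_asym (T : finType) (o : ordering T) x y :
  ord_lt o x y -> ord_lt o y x = false.
Proof. by move=> xy; apply/negP => /(ord_lt_trans xy); rewrite ord_lt_irr. Qed.

(** The events that the model axioms speak of, increasing chains, include the
    elementary events: listing all points increasingly pins down an ordering. *)
Lemma ordering_chain (T : finType) (o : ordering T) :
  exists xs : seq T, forall o', sorted (ord_lt o') xs = (o' == o).
Proof.
pose rank x := #|[pred y | ord_lt o y x]|.
pose xs := sort (relpre rank leq) (enum T).
have all_xs x : x \in xs by rewrite mem_sort mem_enum.
have rank_inj : injective rank.
  move=> x y e; apply/eqP; apply: contraT => /(ord_lt_total o).
  by rewrite -!ordering_rank_mono -/(rank x) -/(rank y) e ltnn.
have sorted_o : sorted (ord_lt o) xs.
  rewrite (@eq_sorted _ _ (relpre rank ltn)) => [|x y]; last first.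
    by rewrite -ordering_rank_mono.
  rewrite -sorted_map ltn_sorted_uniq_leq map_inj_uniq // sort_uniq enum_uniq.
  by rewrite sorted_map sort_sorted // => x y; apply: leq_total.
exists xs => o'; apply/idP/eqP => [sorted_o'|->//].
have imp x y : ord_lt o x y -> ord_lt o' x y.
  move=> xy; case: (ltngtP (index x xs) (index y xs)) => [lt|lt|/index_inj e].
  - exact: (sorted_ltn_index (@ord_lt_trans _ o') sorted_o').
  - have := sorted_ltn_index (@ord_lt_trans _ o) sorted_o _ _ (all_xs y) (all_xs x) lt.
    by rewrite (ord_lt_asym xy).
  - by move: xy; rewrite e ?all_xs // ord_lt_irr.
apply: ord_lt_inj => x y; apply/idP/idP => [xy|]; last exact: imp.
have ne : x != y by apply: contraTneq xy => ->; rewrite ord_lt_irr.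
by case/orP: (ord_lt_total o ne) => // /imp; rewrite (ord_lt_asym xy).
Qed.

Lemma prob_chain_inj (R : realType) (S T : finType) (f : S -> T)
    (f_inj : injective f) (mu : random_ordering R T) (xs : seq S) :
  prob_chain mu [seq f x | x <- xs] =
  \sum_(o : ordering T | sorted (ord_lt (pull f_inj o)) xs) mu o.
Proof.
apply: eq_bigl => o; rewrite sorted_map; apply: eq_sorted => x y.
by rewrite /ord_lt /= ffunE.
Qed.

(** Consistency in the form used from here on: the chain probabilities say that
    the law on [S] is the image of the law on [T] under restriction. *)
Lemma expect_law (R : realType) (S T : finType) (f : S -> T) (f_inj : injective f)
    (mu : random_ordering R S) (nu : random_ordering R T) :
  (forall xs, prob_chain mu xs = prob_chain nu [seq f x | x <- xs]) ->
  forall F, expect nu (fun r => F (restr f r)) = expect mu F.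
Proof.
move=> law F; rewrite [LHS](partition_big (pull f_inj) predT) //=.
apply: eq_bigr => o _; have [xs xsP] := ordering_chain o.
have := law xs; rewrite (prob_chain_inj f_inj) /prob_chain.
rewrite !(eq_bigl _ _ (fun o' => xsP _)) big_pred1_eq => ->.
rewrite mulr_suml; apply: eq_bigr => o' /eqP <- //.
Qed.

Lemma expect_prob_chain (R : realType) (T : finType) (mu : random_ordering R T) xs :
  prob_chain mu xs =
  expect mu (fun r => (sorted (fun x y => r (x, y)) xs)%:R).
Proof.
rewrite /prob_chain big_mkcond; apply: eq_bigr => o _.
by rewrite /ord_lt; case: sorted; rewrite ?mulr1 ?mulr0.
Qed.

Lemma uniform_consistent (R : realType) (P : graph -> Prop) :
  consistent (@uniform_model R P).
Proof.
move=> H G PH PG S phi [phi_bij _] xs.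
have f_inj : injective (fun x => val (phi x)).
  by move=> x y /val_inj; apply/bij_inj.
rewrite !expect_prob_chain -(unif_restr f_inj); apply: eq_expect => o.
rewrite sorted_map; congr (nat_of_bool _)%:R; apply: eq_sorted => x y.
by rewrite ffunE.
Qed.

Section Model.
Variables (R : realType) (P : graph -> Prop) (M : ordering_model R P).
Hypotheses (Piso : graph_property P) (Pher : hereditary P) (Pglue : glue_closed P).
Hypothesis M_consistent : consistent M.

Lemma model_restr (H G : graph) (PH : P H) (PG : P G) (f : H -> G) F :
  embedding f -> expect (M PG) (fun r => F (restr f r)) = expect (M PH) F.
Proof.
move=> f_emb; apply: (expect_law (proj1 f_emb)) => xs.
exact: M_consistent (to_image_iso f_emb) xs.
Qed.

Definition uniform_on (G : graph) : Prop :=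
  forall (PG : P G) F, expect (M PG) F = expect (unif R G) F.

(** * Parts that hang on one vertex are independent of the rest *)

Section Decouple.
Variables (G : graph) (PG : P G) (v : G) (H : graph) (w : H -> G).
Variables (A : finType) (a : A -> G).
Hypotheses (w_emb : embedding w) (v_out : forall h, w h != v)
  (a_out : forall x h, a x != w h)
  (w_hang : forall h y, (forall h', w h' != y) -> y != v -> adj (w h) y = false)
  (HH : uniform_on (dunion H H)).

(** Second moment argument. Let [c] be the left-hand side. With [N.+1] copies
    [Y i] of [Z] hanging on [v], each product [X * Y i] has expectation [c] by
    consistency, whereas the [Y i] are pairwise uncorrelated, because two copies
    of [H] form [dunion H H], which is uniform. So the mean of the [Y i] tends
    to 0 in L2, and by positivity of the square of [X - t * mean] so does [c]. *)
Lemma decouple_centred (F : table A -> R) (Z : table H -> R) :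
  expect (unif R H) Z = 0 ->
  expect (M PG) (fun r => F (restr a r) * Z (restr w r)) = 0.
Proof.
move=> Z0; set c := LHS; apply/eqP; apply: contraT => c_neq0.
pose q := expect (M PG) (fun r => Z (restr w r) ^+ 2).
pose X2 := expect (M PG) (fun r => F (restr a r) ^+ 2).
have q_ge0 : 0 <= q by apply: expect_ge0 => o; apply: sqr_ge0.
(* With this [t] the square of [X - t * mean] has expectation
   [-1 + t ^ 2 * q / N.+1], which is negative since [t ^ 2 * q < N]. *)
pose t := (X2 + 1) / (c *+ 2).
pose N := Num.bound (t ^+ 2 * q).
pose W := w @: [set: H].
have wW h : w h \in W by rewrite imset_f.
have [|x y|K [g [PK g_emb g_out g_dis]]] :=
  hanging_copies Pglue (v := v) (W := W) N PG.
- by apply/negP => /imsetP[h _ /eqP]; rewrite eq_sym (negbTE (v_out h)).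
- case/imsetP=> h _ -> yW; apply: w_hang => h'.
  by apply: contraNneq yW => <-.
have aW x : a x \notin W.
  by apply/negP => /imsetP[h _ /eqP]; rewrite (negbTE (a_out x h)).
pose X r := F (restr (g 0%N \o a) r).
pose Y i r := Z (restr (g i \o w) r).
have EX2 : expect (M PK) (fun r => X r ^+ 2) = X2.
  rewrite /X2 -(model_restr PG PK _ (g_emb 0%N isT)); apply: eq_expect => o.
  by rewrite restr_comp.
have EXY i : (i <= N)%N -> expect (M PK) (fun r => X r * Y i r) = c.
  move=> iN; rewrite /c -(model_restr PG PK _ (g_emb i iN)); apply: eq_expect => o.
  rewrite !restr_comp; congr (F _ * _); apply: eq_restr => x /=.
  by rewrite g_out.
have EY2 i : (i <= N)%N -> expect (M PK) (fun r => Y i r ^+ 2) = q.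
  move=> iN; rewrite /q -(model_restr PG PK _ (g_emb i iN)); apply: eq_expect => o.
  by rewrite restr_comp.
have EYY i j : (i < j <= N)%N -> expect (M PK) (fun r => Y i r * Y j r) = 0.
  case/andP=> ij jN; have iN := leq_trans (ltnW ij) jN.
  pose f (z : dunion H H) : K :=
    match z with inl h => g i (w h) | inr h => g j (w h) end.
  have [gi_inj gi_adj] := g_emb i iN; have [gj_inj gj_adj] := g_emb j jN.
  have [w_inj w_adj] := w_emb.
  have dis h h' : g i (w h) != g j (w h') /\ adj (g i (w h)) (g j (w h')) = false.
    by apply: g_dis; rewrite ?ij ?jN ?wW.
  have f_emb : embedding f.
    split=> [[x|x] [y|y] /=|[x|x] [y|y] /=].
    - by move/gi_inj/w_inj->.
    - by have [/eqP] := dis x y.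
    - by have [/eqP ne _] := dis y x => /esym.
    - by move/gj_inj/w_inj->.
    - by rewrite gi_adj w_adj.
    - by have [] := dis x y.
    - by rewrite adj_sym; have [] := dis y x.
    - by rewrite gj_adj w_adj.
  have PHH : P (dunion H H) := closed_embedding Piso Pher f_emb PK.
  pose ZZ (r : table (dunion H H)) := Z (restr inl r) * Z (restr inr r).
  transitivity (expect (M PHH) ZZ).
    rewrite -(model_restr PHH PK _ f_emb); apply: eq_expect => o.
    by rewrite /ZZ !restr_comp.
  rewrite HH unif_indep //; try by move=> ? ? [].
  by rewrite Z0 mul0r.
pose n := N.+1.
pose S r := \sum_(i < n) Y i r.
have EXS : expect (M PK) (fun r => X r * S r) = n%:R * c.
  transitivity (\sum_(i < n) c); last by rewrite sumr_const card_ord mulr_natl.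
  rewrite -(eq_bigr _ (fun (i : 'I_n) _ => EXY i (ltn_ord i))) -expect_sum.
  by apply: eq_expect => o; rewrite mulr_sumr.
have ES2 : expect (M PK) (fun r => S r ^+ 2) = n%:R * q.
  transitivity (\sum_(i < n) q); last by rewrite sumr_const card_ord mulr_natl.
  rewrite /S (expect_sqr_sum _ (fun i : 'I_n => Y i)).
  apply: eq_bigr => i _; rewrite (bigD1 i) //= big1 ?addr0.
    by rewrite -(EY2 i (ltn_ord i)).
  move=> j ji; case: (ltngtP i j) => [ij|ij|/val_inj e].
  - by apply: EYY; rewrite ij -ltnS ltn_ord.
  - rewrite -(EYY j i); last by rewrite ij -ltnS ltn_ord.
    by apply: eq_expect => o; rewrite mulrC.
  - by rewrite e eqxx in ji.
have n_gt0 : 0 < n%:R :> R by rewrite ltr0n.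
have : 0 <= expect (M PK) (fun r => (X r - t / n%:R * S r) ^+ 2).
  by apply: expect_ge0 => o; apply: sqr_ge0.
have -> : expect (M PK) (fun r => (X r - t / n%:R * S r) ^+ 2) =
    X2 - t * c *+ 2 + t ^+ 2 * q / n%:R.
  transitivity (expect (M PK) (fun r => X r ^+ 2 + ((- (2 * t / n%:R)) * (X r * S r)
    + (t / n%:R) ^+ 2 * S r ^+ 2))).
    by apply: eq_expect => o; ring.
  rewrite expectD EX2 expectD !expectZ EXS ES2; field; exact: lt0r_neq0.
have -> : X2 - t * c *+ 2 = - 1 by rewrite /t; field.
rewrite leNgt => /negP[]; rewrite addrC subr_lt0 ltr_pdivrMr // mul1r.
apply: lt_le_trans (archi_boundP _) _; first by rewrite mulr_ge0 ?sqr_ge0.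
by rewrite ler_nat.
Qed.

(** The table on any set of vertices avoiding [H] is independent of the table
    on [H], and the latter is uniform. *)
Lemma decouple (F : table A -> R) (Z : table H -> R) :
  expect (M PG) (fun r => F (restr a r) * Z (restr w r)) =
  expect (M PG) (fun r => F (restr a r)) * expect (unif R H) Z.
Proof.
set m := expect (unif R H) Z.
apply/eqP; rewrite -subr_eq0 mulrC -expectZ -expectB; apply/eqP.
rewrite -[RHS](@decouple_centred F (fun r => Z r - m)); last first.
  by rewrite expectB expect_cst subrr.
by apply: eq_expect => o; rewrite mulrBr [m * _]mulrC.
Qed.

End Decouple.
End Model.

(** * Reading off interleavings from isolated probes *)

Section Interleave.
Variables (R : realType) (V : finType) (W : {set V}) (n : nat).
Let T : finType := (V + bool * 'I_n)%type.
Implicit Types (r : table T) (x y : V).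

(** [T] is [V] with two families of [n] isolated vertices, the probes: one
    family for each side of the partition of [V] into [~: W] and [W]. *)
Definition side (p : T) : bool :=
  match p with inl x => x \in W | inr (b, _) => b end.

Definition probes_below (b : bool) (r : table T) (p : T) : nat :=
  #|[pred j : 'I_n | r (inr (b, j), p)]|.

(** The approximate position of [x], measured with the probes of its own side. *)
Definition label (r : table T) (x : V) : nat := probes_below (x \in W) r (inl x).

Definition close (k l m : nat) : bool := (l < m + k)%N && (m < l + k)%N.

(** The observables that depend only on the two orderings induced on the sides,
    and not on how these are interleaved. *)
Definition one_sided (h : table T -> R) : Prop :=
  forall r r', (forall p q, side p = side q -> r (p, q) = r' (p, q)) -> h r = h r'.

Definition probe_swap (j : 'I_n) : {perm T} :=
  tperm (inr (false, j)) (inr (true, j)).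

(** A one-sided approximation of the table on [V]: a pair that crosses the
    partition is compared through labels. In the last case a tie is resolved so
    that the entry is the negation of the opposite one. *)
Definition label_table (r : table T) : table V :=
  [ffun p => if (p.1 \in W) == (p.2 \in W) then r (inl p.1, inl p.2)
             else if p.2 \in W then (label r p.1 < label r p.2)%N
             else ~~ (label r p.2 < label r p.1)%N].

Lemma card_interval (I : finType) (f : I -> nat) (m k : nat) :
  injective f -> (#|[pred z | close k (f z) m]| <= k.*2)%N.
Proof.
move=> f_inj; rewrite -(size_iota (m - k) k.*2) cardE -(size_map f).
apply: uniq_leq_size; first by rewrite map_inj_uniq ?enum_uniq.
move=> l /mapP[z]; rewrite mem_enum inE /close mem_iota => /andP[? ?] ->.
by apply/andP; lia.
Qed.

(** Under the uniform law [x] plays the same role as each of the [n] probes of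
    its side, and these [n.+1] points have distinct ranks, at most [k.*2] of
    which are within [k] of the label of [y]. *)
Lemma label_anticoncentration (k : nat) x y : x \notin W -> y \in W ->
  expect (unif R T) (fun r => (close k (label r x) (label r y))%:R) <=
  k.*2%:R / n.+1%:R.
Proof.
move=> xW yW; pose e (z : option 'I_n) : T :=
  if z is Some j then inr (false, j) else inl x.
have e_inj : injective e by case=> [i|] [j|] //= [->].
pose rk r z := #|[pred z' | r (e z', e z)]|.
pose E z r : R := (close k (rk r z) (label r y))%:R.
have rk_label (o : ordering T) : rk (ord_table o) None = label (ord_table o) x.
  rewrite /rk /label /probes_below (negbTE xW).
  rewrite -[RHS](card_image (@Some_inj _)); apply: eq_card => z.
  rewrite inE; apply/idP/imageP => [|[j]]; last by rewrite inE => ? ->.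
  case: z => [j zx|]; first by exists j.
  by rewrite [_ (_, _)](ord_lt_irr o).
have rk_inj (o : ordering T) : injective (rk (ord_table o)).
  suff lt z z' : ord_lt o (e z) (e z') -> (rk (ord_table o) z < rk (ord_table o) z')%N.
    move=> z z' ee; apply/eqP; apply: contraT => ne.
    have /(ord_lt_total o) : e z != e z' by rewrite (inj_eq e_inj).
    by case/orP => /lt; rewrite ee ltnn.
  move=> zz'; apply/proper_card/properP; split.
    by apply/subsetP => z0; rewrite !inE => /(@ord_lt_trans _ o); apply.
  by exists z; rewrite !inE //; apply/negbT/(ord_lt_irr o).
(* Exchange [x] with the probe [e z]; the label of [y] is not affected. *)
have EE z : expect (unif R T) (E z) = expect (unif R T) (E None).
  rewrite -[RHS](unif_perm (tperm (e None) (e z))); apply: eq_expect => o.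
  set s := tperm (e None) (e z); set r := ord_table o.
  rewrite /E; congr (close k _ _)%:R.
    rewrite /rk -(card_image (@perm_inj _ (tperm None z))); apply: eq_card => z'.
    have se u : s (e u) = e (tperm None z u) by rewrite inj_tperm.
    rewrite inE; apply/imageP/idP => [[u]|].
      by rewrite inE => ru ->; rewrite ffunE /= !se tpermL tpermK.
    rewrite ffunE /= !se tpermL => ?; exists (tperm None z z'); rewrite ?tpermK //.
  rewrite /label yW; apply: eq_card => j; rewrite !inE ffunE /=.
  have xy : inl x != inl y :> T by apply: contraNneq xW => -[->].
  by rewrite /s !tpermD //; case: z {s}.
have -> : expect (unif R T) (fun r => (close k (label r x) (label r y))%:R) =
    expect (unif R T) (E None) by apply: eq_expect => o; rewrite /E rk_label.
rewrite ler_pdivlMr ?ltr0n //.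
have -> : expect (unif R T) (E None) * n.+1%:R = \sum_z expect (unif R T) (E z).
  rewrite (eq_bigr _ (fun z _ => EE z)) sumr_const card_option card_ord.
  by rewrite mulr_natr.
rewrite -expect_sum -[leRHS](expect_cst (unif R T)); apply: le_expect => o.
rewrite -natr_sum ler_nat.
apply: leq_trans (card_interval (label (ord_table o) y) k (rk_inj o)).
rewrite -sum1_card [leqRHS]big_mkcond; apply: leq_sum => z _.
by rewrite inE; case: (close _ _ _).
Qed.

Section Measure.
Variable mu : random_ordering R T.
Hypothesis mu_one_sided : forall h, one_sided h -> expect mu h = expect (unif R T) h.
Hypothesis mu_swap : forall j F,
  expect mu (fun r => F (restr (probe_swap j) r)) = expect mu F.

(** Swapping the two probes of index [j] changes the sign of the contribution
    of [j], so distinct contributions are uncorrelated. *)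
Lemma probe_variance y :
  expect mu (fun r => ((probes_below false r (inl y))%:R -
                   (probes_below true r (inl y))%:R) ^+ 2) <= n%:R.
Proof.
pose d (j : 'I_n) r : R :=
  (r (inr (false, j), inl y))%:R - (r (inr (true, j), inl y))%:R.
have dE r : (probes_below false r (inl y))%:R -
    (probes_below true r (inl y))%:R = \sum_j d j r.
  rewrite sumrB /probes_below -!sum1_card !natr_sum.
  by rewrite big_mkcond [X in _ - X = _]big_mkcond; congr (_ - _);
     apply: eq_bigr => j _; rewrite inE; case: (r _).
under [X in X <= _]eq_bigr => o _ do rewrite dE.
rewrite -/(expect mu (fun r => (\sum_j d j r) ^+ 2)) expect_sqr_sum.
rewrite -[X in _ <= X%:R]card_ord -sum1_card natr_sum; apply: ler_sum => i _.
rewrite (bigD1 i) //= big1 ?addr0 => [|j ji].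
  rewrite -[leRHS](expect_cst mu); apply: le_expect => o; rewrite /d.
  by do 2!case: (ord_table o _); rewrite /= ?subrr ?subr0 ?sub0r ?mulr0 ?mulrNN ?mulr1.
apply/eqP; rewrite -[_ == 0](mulrn_eq0 _ 2) mulr2n -[X in X + _](mu_swap i).
rewrite -expectD; apply/eqP; rewrite -[RHS](expect_cst mu); apply: eq_expect => o.
rewrite /d !ffunE /= /probe_swap tpermL tpermR !tpermD //.
  by rewrite mulrC; ring.
all: by apply: contraNneq ji => -[->].
Qed.

Definition order_mismatch r x y : R :=
  (r (inl x, inl y) != (label r x < label r y)%N)%:R.

(** Whatever the order of [x] and [y], the number of [x]-side probes below [x]
    compares with the number of [x]-side probes below [y] accordingly. If the
    labels disagree with that order, then either the two probe families differ
    by at least [k] below [y], which is unlikely by Chebyshev, or the labels of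
    [x] and [y] are within [k], which is unlikely by anticoncentration. *)
Lemma order_mismatch_small (k : nat) x y : (0 < k)%N -> x \notin W -> y \in W ->
  expect mu (fun r => order_mismatch r x y) <= n%:R / k%:R ^+ 2 + k.*2%:R / n.+1%:R.
Proof.
move=> k0 xW yW.
pose D r : R := (probes_below false r (inl y))%:R -
                   (probes_below true r (inl y))%:R.
pose E r : R := (close k (label r x) (label r y))%:R.
have k2 : 0 < k%:R ^+ 2 :> R by rewrite exprn_gt0 ?ltr0n.
apply: (@le_trans _ _ (expect mu (fun r => (k%:R ^+ 2)^-1 * D r ^+ 2 + E r))).
  apply: le_expect => o; rewrite /order_mismatch /E /D.
  set r := ord_table o; set C := probes_below false r (inl y).
  have Ly : label r y = probes_below true r (inl y) by rewrite /label yW.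
  rewrite -Ly.
  have Lx : label r x = probes_below false r (inl x).
    by rewrite /label (negbTE xW).
  have mono p q : ord_lt o p q -> (probes_below false r p <= probes_below false r q)%N.
    move=> pq; apply/subset_leq_card/subsetP => j; rewrite !inE => jp.
    exact: ord_lt_trans jp pq.
  have D0 : 0 <= (k%:R ^+ 2)^-1 * (C%:R - (label r y)%:R) ^+ 2 :> R.
    by rewrite mulr_ge0 ?sqr_ge0 ?invr_ge0 ?ltW.
  case: eqP => [_|neq] /=; first by rewrite addr_ge0 // ler0n.
  have [cl|ncl] := boolP (close k _ _); first by rewrite lerDr.
  rewrite addr0 mulrC ler_pdivlMr // mul1r.
  have far : (label r y + k <= C)%N \/ (C + k <= label r y)%N.
    have ne : inl x != inl y :> T by apply: contraNneq xW => -[->].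
    move: ncl neq; rewrite /close -[r _]/(ord_lt o _ _).
    case: (boolP (ord_lt o _ _)) => [xy|nxy].
      by have := mono _ _ xy; rewrite -Lx -/C; case: ltnP => //; lia.
    have := ord_lt_total o ne; rewrite (negbTE nxy) /= => /mono.
    by rewrite -Lx -/C; case: ltnP => //; lia.
  have : k%:R <= `|C%:R - (label r y)%:R| :> R.
    case: far => far.
      by apply: le_trans (ler_norm _); rewrite lerBrDr -natrD ler_nat addnC.
    rewrite distrC; apply: le_trans (ler_norm _).
    by rewrite lerBrDr -natrD ler_nat addnC.
  move=> le_kd; rewrite -[leRHS]real_normK ?num_real //.
  by rewrite lerXn2r ?nnegrE ?ler0n.
rewrite expectD expectZ lerD //.
  by rewrite mulrC ler_pM2r ?invr_gt0 //; exact: probe_variance.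
rewrite mu_one_sided; first exact: label_anticoncentration.
move=> r r' rr'; rewrite /E; congr (close k _ _)%:R;
  by apply: eq_card => j; rewrite !inE rr'.
Qed.

Lemma label_table_approx (k : nat) (F : table V -> R) :
  (0 < k)%N -> (forall t, `|F t| <= 1) ->
  `|expect mu (fun r => F (restr inl r)) - expect mu (fun r => F (label_table r))| <=
  2 * #|V|%:R ^+ 2 * (n%:R / k%:R ^+ 2 + k.*2%:R / n.+1%:R).
Proof.
move=> k0 F1; set d := n%:R / _ + _.
have d0 : 0 <= d by rewrite addr_ge0 // mulr_ge0 ?invr_ge0 ?exprn_ge0 ?ler0n.
rewrite -expectB; apply: le_trans (norm_expect _ _) _.
pose B r : R := \sum_(x | x \notin W) \sum_(y | y \in W) order_mismatch r x y.
have term0 r x y : 0 <= order_mismatch r x y by apply: ler0n.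
have B0 r : 0 <= B r by do 2!(apply: sumr_ge0 => ? _).
apply: (@le_trans _ _ (expect mu (fun r => 2 * B r))).
  apply: le_expect => o; set r := ord_table o.
  have [/existsP[x /existsP[y /and3P[xW yW bad]]]|good] := boolP
    [exists x, exists y, [&& x \notin W, y \in W &
       r (inl x, inl y) != (label r x < label r y)%N]].
    apply: (@le_trans _ _ 2).
      apply: le_trans (ler_normB _ _) _.
      by rewrite -[2]/(1 + 1) lerD.
    rewrite ler_peMr // /B (bigD1 x) //= (bigD1 y) //= {1}/order_mismatch bad.
    by rewrite -addrA lerDl addr_ge0 //; do ?(apply: sumr_ge0 => ? _).
  have -> : restr inl r = label_table r.
    have agree x y : x \notin W -> y \in W ->
        r (inl x, inl y) = (label r x < label r y)%N.
      move=> xW yW; apply/eqP; apply: contraNT good => bad.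
      by apply/existsP; exists x; apply/existsP; exists y; rewrite xW yW.
    apply/ffunP=> -[x y]; rewrite !ffunE /=.
    case: (boolP (x \in W)) (boolP (y \in W)) => [xW|xW] [yW|yW] //=; last exact: agree.
    rewrite -(agree y x) //.
    have ne : inl x != inl y :> T by apply: contraNneq yW => -[<-].
    case: (boolP (r (inl x, inl y))) => [xy|nxy].
      by rewrite [r _](ord_lt_asym (o := o)).
    by have := ord_lt_total o ne; rewrite /ord_lt (negbTE nxy) /= => ->.
  by rewrite subrr normr0 mulr_ge0.
rewrite expectZ -mulrA ler_pM2l ?ltr0n // /B.
rewrite expect_sum.
have cardV (Q : pred V) : \sum_(x | Q x) d <= #|V|%:R * d.
  rewrite sumr_const -[leLHS]mulr_natl ler_wpM2r // ler_nat; exact: max_card.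
apply: (@le_trans _ _ (\sum_(x | x \notin W) #|V|%:R * d)).
  apply: ler_sum => x xW; rewrite expect_sum; apply: le_trans (cardV (mem W)).
  by apply: ler_sum => y yW; apply: order_mismatch_small.
rewrite -mulr_sumr expr2 -mulrA ler_wpM2l ?ler0n //; exact: cardV.
Qed.

End Measure.

(** A law that is uniform on one-sided observables and invariant under swaps of
    probes is almost uniform on [V]: [label_table] approximates the table on [V]
    under both laws, and is itself one-sided. *)
Lemma interleave_bound (mu : random_ordering R T) (k : nat) (F : table V -> R) :
  (forall h, one_sided h -> expect mu h = expect (unif R T) h) ->
  (forall j F, expect mu (fun r => F (restr (probe_swap j) r)) = expect mu F) ->
  (0 < k)%N -> (forall t, `|F t| <= 1) ->
  `|expect mu (fun r => F (restr inl r)) - expect (unif R V) F| <=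
  4 * #|V|%:R ^+ 2 * (n%:R / k%:R ^+ 2 + k.*2%:R / n.+1%:R).
Proof.
move=> mu1 mus k0 F1.
have os : one_sided (fun r => F (label_table r)).
  move=> r r' rr'; congr F; apply/ffunP => -[x y]; rewrite !ffunE /=.
  have lE z : label r z = label r' z.
    by apply: eq_card => j; rewrite !inE rr'.
  by rewrite !lE; case: eqP => // e; apply: rr'.
have := label_table_approx mu1 mus k0 F1.
have := @label_table_approx (unif R T) (fun h _ => erefl)
  (fun j => unif_perm (probe_swap j)) k F k0 F1.
rewrite (unif_restr (@inl_inj V (bool * 'I_n)%type)) (mu1 _ os).
move=> near_unif near_mu.
have -> : 4 = 2 + 2 :> R by ring.
rewrite -(subrKA (expect (unif R T) (fun r => F (label_table r)))) mulrDl mulrDl.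
by apply: le_trans (ler_normD _ _) (lerD near_mu _); rewrite distrC.
Qed.

End Interleave.

(** * Joint laws and limits *)

(** Product observables determine all observables of the pair of restrictions,
    because the indicators of pairs of tables are products. *)
Lemma joint_law (R : realType) (S1 S2 T : finType) (f1 : S1 -> T) (f2 : S2 -> T)
    (mu nu : random_ordering R T) :
  (forall F1 F2, expect mu (fun r => F1 (restr f1 r) * F2 (restr f2 r)) =
                 expect nu (fun r => F1 (restr f1 r) * F2 (restr f2 r))) ->
  forall h : table T -> R,
  (forall r r', restr f1 r = restr f1 r' -> restr f2 r = restr f2 r' -> h r = h r') ->
  expect mu h = expect nu h.
Proof.
move=> law h h_fact.
(* The function of the two restricted tables through which [h] factors. *)
pose Phi t1 t2 : R :=
  if [pick r | (restr f1 r == t1) && (restr f2 r == t2)] is Some r then h r else 0.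
pose G t1 t2 (r : table T) : R :=
  Phi t1 t2 * ((restr f1 r == t1)%:R * (restr f2 r == t2)%:R).
have hE (r : table T) : h r = \sum_t1 \sum_t2 G t1 t2 r.
  rewrite (bigD1 (restr f1 r)) //= (bigD1 (restr f2 r)) //= !big1 ?addr0.
  - rewrite /G !eqxx !mulr1 /Phi; case: pickP => [r' /andP[/eqP e1 /eqP e2]|].
      by apply: h_fact.
    by move=> /(_ r); rewrite !eqxx.
  - move=> t1 ne; apply: big1 => t2 _.
    by rewrite /G [_ == t1]eq_sym (negbTE ne) /= mul0r mulr0.
  - by move=> t2 ne; rewrite /G [_ == t2]eq_sym (negbTE ne) /= !mulr0.
have ExE (la : random_ordering R T) : expect la h = \sum_t1 \sum_t2 expect la (G t1 t2).
  transitivity (expect la (fun r => \sum_t1 \sum_t2 G t1 t2 r)).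
    by apply: eq_expect => o; apply: hE.
  by rewrite expect_sum; apply: eq_bigr => t1 _; rewrite expect_sum.
rewrite !ExE; apply: eq_bigr => t1 _; apply: eq_bigr => t2 _.
rewrite !expectZ; congr (_ * _).
exact: (law (fun t => (t == t1)%:R) (fun t => (t == t2)%:R)).
Qed.

Lemma card_le_in (S T : finType) (A : pred S) (B : pred T) (f : S -> T) :
  {in A &, injective f} -> (forall x, x \in A -> f x \in B) -> (#|A| <= #|B|)%N.
Proof.
move=> f_inj fAB; rewrite -(card_in_imset f_inj).
by apply/subset_leq_card/subsetP => _ /imsetP[x xA ->]; apply: fAB.
Qed.

Lemma archimedean_le0 (R : realType) (a c : R) :
  (forall m : nat, (0 < m)%N -> a <= c / m%:R) -> a <= 0.
Proof.
move=> small; rewrite leNgt; apply/negP => a0.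
have m0 : (0 < Num.bound (c / a))%N.
  rewrite lt0n; apply/eqP => b0.
  have := small 1%N isT; rewrite divr1 => ac.
  have ca0 : 0 <= c / a by rewrite divr_ge0 ?(ltW a0) // (le_trans (ltW a0)).
  have := archi_boundP ca0; rewrite b0 => ca; by have := le_lt_trans ca0 ca; rewrite ltxx.
have := small _ m0; rewrite ler_pdivlMr ?ltr0n // => le_c.
have c0 : 0 <= c by apply: le_trans le_c; rewrite mulr_ge0 ?ler0n ?ltW.
have := archi_boundP (divr_ge0 c0 (ltW a0)).
by rewrite ltr_pdivrMr // ltNge mulrC le_c.
Qed.

(** With [m ^ 3] probes and tolerance [m ^ 2] both error terms of
    [interleave_bound] vanish as [m] grows. *)
Lemma probe_rate (R : realType) (m : nat) : (0 < m)%N ->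
  (m ^ 3)%:R / (m ^ 2)%:R ^+ 2 + (m ^ 2).*2%:R / (m ^ 3).+1%:R <= 3 / m%:R :> R.
Proof.
move=> m0; have m0R : 0 < m%:R :> R by rewrite ltr0n.
have -> : (m ^ 3)%:R / (m ^ 2)%:R ^+ 2 = 1 / m%:R :> R.
  by rewrite !natrX; field; exact: lt0r_neq0.
rewrite -[3]/(1 + 2 : R) mulrDl lerD2l.
rewrite ler_pdivrMr ?ltr0n // mulrAC ler_pdivlMr // -!natrM ler_nat.
by rewrite -mul2n; nia.
Qed.

(** * Uniformity by induction on the size of the classes *)

Section Hanging.
Variables (R : realType) (P : graph -> Prop) (M : ordering_model R P).
Hypotheses (Piso : graph_property P) (Pher : hereditary P) (Pglue : glue_closed P).
Hypothesis M_consistent : consistent M.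
Notation uniform_on := (uniform_on M).

Definition probed (G : graph) (n : nat) : graph := dunion G (empty_graph 'I_n).

(** Add probes for both sides. As the probes are isolated, [W] with its probes
    still hangs on [v], so that [decouple] and the two uniformity hypotheses make
    the sides independent and uniform; [interleave_bound] then gives the ordering of [G] up to an error that
    vanishes with the number of probes. *)
Lemma hanging_uniform (G : graph) (v : G) (W : {set G}) :
  v \notin W -> W != set0 ->
  (forall x y, x \in W -> y \notin W -> y != v -> adj x y = false) ->
  (forall n, uniform_on (probed (induced (~: W)) n)) ->
  (forall n, uniform_on (dunion (probed (induced W) n) (probed (induced W) n))) ->
  uniform_on G.
Proof.
move=> vW /set0Pn[u uW] hang unifB unifWW PG F.
have uv : u != v by apply: contraNneq vW => <-.
(* [interleave_bound] wants an observable bounded by 1. *)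
pose c := 1 + \sum_t `|F t|.
have c0 : 0 < c by rewrite ltr_pwDl // sumr_ge0.
pose F1 t := c^-1 * F t.
have F1_le1 t : `|F1 t| <= 1.
  rewrite normrM normfV (gtr0_norm c0) ler_pdivrMl // mulr1 /c (bigD1 t) //=.
  by rewrite addrCA lerDl addr_ge0 // sumr_ge0.
suff : expect (M PG) F1 = expect (unif R G) F1.
  by rewrite !expectZ; apply/mulfI; rewrite invr_neq0 // lt0r_neq0.
apply/eqP; rewrite -subr_eq0 -normr_le0.
apply: (@archimedean_le0 _ _ (4 * #|G|%:R ^+ 2 * 3)) => m m0.
pose n := (m ^ 3)%N; pose K := dunion G (empty_graph (bool * 'I_n)%type).
have PK : P K := isolated_vertices Piso Pher Pglue _ uv PG.
pose join (S : {set G}) (b : bool) (z : probed (induced S) n) : K :=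
  match z with inl x => inl (val x) | inr j => inr (b, j) end.
have join_emb S b : embedding (@join S b).
  split=> [[x|i] [y|j] //= [e]|[x|i] [y|j] //]; last by rewrite e.
  by rewrite (val_inj e).
have inl_emb : embedding (inl : G -> K) by split=> // x y [].
have dis (z : probed (induced (~: W)) n) (z' : probed (induced W) n) :
    join (~: W) false z != join W true z'.
  case: z z' => [x|i] [y|j] //=; apply/eqP => -[e].
  by have := valP x; rewrite inE (e : val x = val y) (valP y).
have w_hang (h : probed (induced W) n) (y : K) :
    (forall h', join W true h' != y) -> y != inl v -> adj (join W true h) y = false.
  case: h y => [[x xW]|i] [y|j] //= nW yv.
  apply: hang => //.
  by apply/negP => yW; have := nW (inl (exist _ y yW)); rewrite eqxx.
have v_out (h : probed (induced W) n) : join W true h != inl v.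
  case: h => [x|i] //; apply/eqP => -[e].
  by have := valP x; rewrite (e : val x = v) (negbTE vW).
have PB : P (probed (induced (~: W)) n) :=
  closed_embedding Piso Pher (join_emb (~: W) false) PK.
rewrite -(model_restr M_consistent PG PK _ inl_emb).
apply: le_trans (@interleave_bound R G W n (M PK) (m ^ 2) F1 _ _ _ F1_le1) _.
- move=> h h_os; apply: (joint_law (f1 := join (~: W) false) (f2 := join W true)).
    move=> Fb Fw.
    rewrite (decouple Piso Pher Pglue M_consistent PK (join_emb W true)
      v_out dis w_hang) //.
    rewrite (model_restr M_consistent PB PK _ (join_emb _ _)) unifB.
    by rewrite unif_indep //; [apply: (join_emb _ _).1|apply: (join_emb _ _).1].
  move=> r r' eB eW; apply: h_os => p q pq.
  have inB S b z z' : restr (join S b) r = restr (join S b) r' ->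
      r (join S b z, join S b z') = r' (join S b z, join S b z').
    by move/ffunP/(_ (z, z')); rewrite !ffunE.
  have locW (p' : K) : side W p' = true -> exists z, p' = join W true z.
    by case: p' => [x xW|[b j] /= ->]; [exists (inl (exist _ x xW))|exists (inr j)].
  have locB (p' : K) : side W p' = false -> exists z, p' = join (~: W) false z.
    case: p' => [x /negbT xW|[b j] /= ->]; last by exists (inr j).
    have xB : x \in ~: W by rewrite inE.
    by exists (inl (exist _ x xB)).
  case e : (side W q) pq => pq.
    by have [z ->] := locW p pq; have [z' ->] := locW q e; apply: inB.
  by have [z ->] := locB p pq; have [z' ->] := locB q e; apply: inB.
- move=> j F2; apply: (model_restr M_consistent PK PK F2).
  split=> [|p q]; first exact: perm_inj.
  have sl x : probe_swap G j (inl x) = inl x by rewrite /probe_swap tpermD.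
  have sr q' : exists q'', probe_swap G j (inr q') = inr q''.
    by rewrite /probe_swap; case: tpermP => *; eexists.
  case: p q => [x|p] [y|q]; rewrite ?sl //;
    do ?[have [? ->] := sr p]; do ?[have [? ->] := sr q] => //.
- by rewrite expn_gt0 m0.
rewrite -[leRHS]mulrA ler_wpM2l ?mulr_ge0 ?exprn_ge0 ?ler0n //.
exact: probe_rate.
Qed.

Lemma edgeless_uniform (G : graph) : (forall x y : G, adj x y = false) -> uniform_on G.
Proof.
move=> no_edge PG; apply: exchangeable_uniform => s F.
apply: (model_restr M_consistent PG PG F).
by split=> [|x y]; [exact: perm_inj|rewrite !no_edge].
Qed.

(** The classes of a map [c] constant along edges are unions of components; they
    stand in for the components, which change under deletions. *)
Definition class (G : graph) (I : finType) (c : G -> I) (x : G) : pred G :=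
  [pred y | c y == c x].

(** Outer induction on the bound [n], inner induction on the number of
    vertices in classes of maximal size [n.+2], kept below [m]. Split such a class as [v] and
    [W]. Deleting [W] isolates [v] and lowers [m], while [W] and its duplicates
    only have classes of size at most [n.+1]. The outer induction has to bound
    classes, and not the order of [G], because [W] gets duplicated. *)
Lemma bounded_classes_uniform (n : nat) (G : graph) (I : finType) (c : G -> I) :
  (forall x y, adj x y -> c x = c y) -> (forall x, (#|class c x| <= n.+1)%N) ->
  uniform_on G.
Proof.
elim: n G I c => [|n IHn] G I c c_adj c_le.
  apply: edgeless_uniform => x y; apply/negP => xy.
  have ne : x != y by apply: contraTneq xy => ->; rewrite (adj_irr y).
  have := c_le x; rewrite leqNgt => /negP[].
  rewrite (cardD1 x) (cardD1 y) !inE eqxx eq_sym ne (c_adj _ _ xy) eqxx.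
  by rewrite addnA leq_addr.
pose big (G' : graph) (I' : finType) (c' : G' -> I') :=
  [pred x | #|class c' x| == n.+2].
have [m] := ubnP #|big G I c|; elim: m => // m IHm in G I c c_adj c_le *.
move=> big_m.
have [v v_big|no_big] := pickP (big G I c); last first.
  apply: (IHn G I c) => // x; rewrite -ltnS ltn_neqAle c_le andbT.
  by have := no_big x; rewrite inE => ->.
pose W := [set y | c y == c v] :\ v.
have cW x : x \in W -> c x = c v by rewrite !inE => /andP[_ /eqP].
have cardW : #|W| = n.+1.
  have := eqP v_big; rewrite (cardD1 v) inE eqxx => -[<-].
  by apply: eq_card => y; rewrite !inE.
apply: (@hanging_uniform G v W).
- by rewrite !inE eqxx.
- by rewrite -card_gt0 cardW.
- move=> x y xW yW yv; apply/negP => /c_adj e.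
  by move: yW; rewrite !inE yv -e (cW x xW) eqxx.
(* The complement of [W], with its probes, has fewer vertices in classes of
   maximal size: [v] has become a class of its own. *)
- move=> k; pose B := probed (induced (~: W)) k.
  pose cB (z : B) : I + 'I_k :=
    match z with inl x => inl (c (val x)) | inr j => inr j end.
  pose f (z : B) : G := if z is inl x then val x else v.
  have f_inj z : {in class cB z &, injective f}.
    case: z => [z|z] [x|i] [y|j]; rewrite !inE //=.
      by move=> _ _ /val_inj ->.
    by move=> /eqP[->] /eqP[->].
  have cB_le x : (#|class cB (inl x)| <= #|class c (val x)|)%N.
    by apply: card_le_in (@f_inj _) _ => -[y|j] //; rewrite !inE.
  have cB_probe j : (#|class cB (inr j)| <= 1)%N.
    rewrite -(card1 (inr j : B)); apply: (@card_le_in _ _ _ _ id) => [? ? ? ? //|].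
    by case=> [x|i]; rewrite !inE // => /eqP[->].
  apply: (IHm B _ cB).
  + by case=> [x|i] [y|j] //= /c_adj e; rewrite /= e.
  + case=> [x|j]; first exact: leq_trans (cB_le x) (c_le _).
    exact: leq_trans (cB_probe j) _.
  have bigB z : z \in big B _ cB -> f z \in [predD1 big G I c & v] /\ exists x, z = inl x.
    case: z => [x|j]; rewrite !inE => /eqP e; last by have := cB_probe j; rewrite e.
    have xv : val x != v.
      apply/eqP => xv; have : (#|class cB (inl x)| <= 1)%N; last by rewrite e.
      rewrite -(card1 v); apply: card_le_in (@f_inj _) _ => -[y|j] //.
      rewrite !inE /= => /eqP[]; rewrite (xv : sval x = v) => cy.
      by have := valP y; rewrite !inE cy eqxx andbT negbK.
    by split; [rewrite xv /= eqn_leq c_le -e cB_le | exists x].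
  rewrite (cardD1 v) (v_big : v \in big G I c) add1n ltnS in big_m.
  apply: leq_ltn_trans big_m; apply: (card_le_in (f := f)) => [z z'|z /bigB[] //].
  move=> /bigB[_ [x ->]] /bigB[_ [y ->]].
  by move=> /val_inj ->.
(* In two copies of [W] with its probes, each copy of [W] is one class, and
   each probe is a class of its own. *)
move=> k; pose H := probed (induced W) k.
pose cH (z : H) : option 'I_k := if z is inr j then Some j else None.
pose cHH (z : dunion H H) : bool * option 'I_k :=
  match z with inl h => (false, cH h) | inr h => (true, cH h) end.
have cH_adj (x y : H) : adj x y -> cH x = cH y by case: x y => [x|i] [y|j].
apply: (IHn (dunion H H) _ cHH).
  by case=> [x|x] [y|y] //= xy; congr pair; apply: cH_adj.
pose f (z : dunion H H) : option G :=
  let: h := match z with inl h => h | inr h => h end in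
  if h is inl x then Some (val x) else None.
move=> z; have f_inj : {in class cHH z &, injective f}.
  move=> x y; rewrite !inE => /eqP <- /eqP; case: x y => [[x|i]|[x|i]] [[y|j]|[y|j]] //=.
  - by move=> _ [/val_inj ->].
  - by move=> [->].
  - by move=> _ [/val_inj ->].
  - by move=> [->].
case e : (cHH z).2 => [j|].
  apply: (@leq_trans #|pred1 (None : option G)|); last by rewrite card1.
  apply: card_le_in f_inj _ => x; rewrite !inE => /eqP ex.
  by move: e; rewrite -ex; case: x {ex} => [[x|i]|[x|i]].
apply: (@leq_trans #|Some @: W|); last first.
  by rewrite card_imset ?cardW //; exact: Some_inj.
apply: card_le_in f_inj _ => x; rewrite inE => /eqP ex.
move: e; rewrite -ex.
by case: x {ex} => [[x|i]|[x|i]] //= _; apply: imset_f; exact: valP.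
Qed.

End Hanging.

Theorem theorem1p6 (R : realType) (P : graph -> Prop)
    (P_property : graph_property P)
    (P_hereditary : hereditary P)
    (P_glue : glue_closed P) :
  uniform_property R P.
Proof.
split; first exact: uniform_consistent.
move=> M M_consistent G PG o.
have mass_expect (mu : random_ordering R G) :
    mu o = expect mu (fun r => (r == ord_table o)%:R).
  rewrite /expect (bigD1 o) //= eqxx mulr1 big1 ?addr0 // => o' ne.
  by rewrite [_ == _](negbTE ne) /= mulr0.
rewrite !mass_expect; pose c (x : G) := tt.
apply: (bounded_classes_uniform P_property P_hereditary P_glue M_consistent
  (n := #|G|) (c := c)) => // x; exact/leqW/max_card.
Qed.
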